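(* If $R$ is a tolerance on a set $U$, then the ordered sets $\mathit{RS}=\{(X^{\blacktriangledown},X^{\blacktriangle})\mid X\subseteq U\}$ and $\{((X^{\blacktriangledown})^{\blacktriangle},(X^{\blacktriangle})^{\blacktriangledown})\mid X\subseteq U\}$ are order-isomorphic.
   Context: A tolerance on $U$ is a reflexive and symmetric binary relation $R$ on $U$; $R(x)=\{y\in U\mid x\,R\,y\}$. For $X\subseteq U$, $X^{\blacktriangledown}=\{x\in U\mid R(x)\subseteq X\}$ and $X^{\blacktriangle}=\{x\in U\mid R(x)\cap X\neq\emptyset\}$. Both sets of pairs are ordered coordinatewise by inclusion: $(A,B)\le(C,D)$ iff $A\subseteq C$ and $B\subseteq D$. *)

(* Defs.v *)
From HB Require Import structures.
From mathcomp Require Import all_boot all_order.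
From mathcomp Require Import all_classical.

Set Implicit Arguments.
Unset Strict Implicit.
Unset Printing Implicit Defensive.

Import Order.TTheory.

Local Open Scope classical_set_scope.

(* [set_type A], the type of the elements of [A], with the order induced from
   the ambient partially ordered type. *)
HB.instance Definition _ (d : Order.disp_t) (T : porderType d) (A : set T) :=
  SubChoice.copy (set_type A) {x : T | x \in A}.
HB.instance Definition _ (d : Order.disp_t) (T : porderType d) (A : set T) :=
  [SubChoice_isSubPOrder of set_type A by <: with d].

Definition order_isomorphic (d1 d2 : Order.disp_t)
    (P : porderType d1) (Q : porderType d2) : Prop :=
  exists f : P -> Q, bijective f /\ {mono f : x y / (x <= y)%O}.

Section Tolerance.

Variables (U : Type) (R : U -> U -> Prop).

Definition tolerance : Prop :=
  (forall x, R x x) /\ (forall x y, R x y -> R y x).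

(* [R x], as a [set U], is the neighbourhood R(x) = {y | x R y}. *)
Definition lower (X : set U) : set U := [set x | R x `<=` X].

Definition upper (X : set U) : set U := [set x | R x `&` X !=set0].

(* [*p] is the product with the coordinatewise order, and [set U] is ordered
   by inclusion. *)
Definition RS : set (set U *p set U) := [set (lower X, upper X) | X in setT].

Definition RS_lower_upper : set (set U *p set U) :=
  [set (upper (lower X), lower (upper X)) | X in setT].

End Tolerance.

(* Main.v *)
(* Symmetry of [R] makes [upper] left adjoint to [lower], so that
   lower (upper (lower X)) = lower X and upper (lower (upper X)) = upper X.
   Hence (A, B) |-> (upper A, lower B) and (C, D) |-> (lower C, upper D) are
   mutually inverse monotone maps between the two ordered sets. *)
Require Import Defs.
From mathcomp Require Import all_boot all_order.
From mathcomp Require Import all_classical.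

Set Implicit Arguments.
Unset Strict Implicit.
Unset Printing Implicit Defensive.

Import Order.TTheory.

Local Open Scope classical_set_scope.

(** Since [g] is monotone and undoes [f] on [A], [f] also reflects the order there. Taking [f] and
    [g] on the ambient types confines the handling of membership proofs to this lemma. *)
Lemma set_type_order_isomorphic (d1 d2 : Order.disp_t)
    (S : porderType d1) (T : porderType d2) (A : set S) (B : set T)
    (f : S -> T) (g : T -> S) :
  set_fun A B f -> set_fun B A g ->
  (forall x, A x -> g (f x) = x) -> (forall y, B y -> f (g y) = y) ->
  {homo f : x y / (x <= y)%O} -> {homo g : x y / (x <= y)%O} ->
  order_isomorphic (set_type A) (set_type B).
Proof.
move=> fAB gBA fK gK f_homo g_homo.
have AP (x : set_type A) : A (\val x) by exact: set_mem (valP x).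
have BP (y : set_type B) : B (\val y) by exact: set_mem (valP y).
pose F (x : set_type A) : set_type B := SigSub (mem_set (fAB _ (AP x))).
pose G (y : set_type B) : set_type A := SigSub (mem_set (gBA _ (BP y))).
exists F; split.
  by exists G => [x | y]; apply: val_inj; [exact: fK | exact: gK].
move=> x y; rewrite -!Order.le_val /=; apply/idP/idP => [|/f_homo //].
by move=> /g_homo; rewrite (fK _ (AP x)) (fK _ (AP y)).
Qed.

Section Galois.

Variables (U : Type) (R : U -> U -> Prop).

Lemma lower_subset (X Y : set U) : X `<=` Y -> lower R X `<=` lower R Y.
Proof. by move=> XY x RxX y /RxX /XY. Qed.

Lemma upper_subset (X Y : set U) : X `<=` Y -> upper R X `<=` upper R Y.
Proof. by move=> XY x [y [Rxy /XY Yy]]; exists y. Qed.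

Hypothesis R_sym : forall x y, R x y -> R y x.

(** If [y] lies in [R x] and [R y] is contained in [X], symmetry puts [x] in [R y], hence in [X]. *)
Lemma upper_lower_subset (X : set U) : upper R (lower R X) `<=` X.
Proof. by move=> x [y [/R_sym Ryx]]; apply. Qed.

(** For [x] in [X] and [y] in [R x], symmetry makes [x] itself a common point of [R y] and [X]. *)
Lemma subset_lower_upper (X : set U) : X `<=` lower R (upper R X).
Proof. by move=> x Xx y /R_sym Ryx; exists x. Qed.

Lemma lower_upper_lower (X : set U) :
  lower R (upper R (lower R X)) = lower R X.
Proof.
apply/seteqP; split; last exact: subset_lower_upper.
by apply: lower_subset; apply: upper_lower_subset.
Qed.

Lemma upper_lower_upper (X : set U) :
  upper R (lower R (upper R X)) = upper R X.
Proof.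
apply/seteqP; split; first exact: upper_lower_subset.
by apply: upper_subset; apply: subset_lower_upper.
Qed.

End Galois.

Theorem lemma4p1 (U : Type) (R : U -> U -> Prop) (R_tol : tolerance R) :
  order_isomorphic (set_type (RS R)) (set_type (RS_lower_upper R)).
Proof.
have [_ R_sym] := R_tol.
apply: (@set_type_order_isomorphic _ _ _ _ _ _
  (fun p : set U *p set U => (upper R p.1, lower R p.2) : set U *p set U)
  (fun p : set U *p set U => (lower R p.1, upper R p.2) : set U *p set U)).
- by move=> _ [X _ <-]; exists X.
(* The same [X] serves as witness on the way back: the triple composites collapse to [lower R X] and
   [upper R X]. *)
- move=> _ [X _ <-]; exists X => //=.
  by rewrite lower_upper_lower // upper_lower_upper.
- by move=> _ [X _ <-] /=; rewrite lower_upper_lower // upper_lower_upper.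
- by move=> _ [X _ <-] /=; rewrite lower_upper_lower // upper_lower_upper.
- move=> p q; rewrite !leEprod => /andP[/subsetPset p1 /subsetPset p2].
  by apply/andP; split; apply/subsetPset; [exact: upper_subset | exact: lower_subset].
- move=> p q; rewrite !leEprod => /andP[/subsetPset p1 /subsetPset p2].
  by apply/andP; split; apply/subsetPset; [exact: lower_subset | exact: upper_subset].
Qed.
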